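(* Let $\mathbf f=f_0f_1f_2\cdots=0100\cdots$ be the Fibonacci word, $f_{t-1}=\lfloor (t+1)\gamma\rfloor-\lfloor t\gamma\rfloor$ ($t\ge1$), $\gamma=(3-\sqrt5)/2$, and let $T(i,m,n)=\sum_{k=0}^{m-1}\sum_{\ell=0}^{n-1}f_{i+k+\ell}$. For every integer $k\ge1$, with $m=n=F_{3k}/2$, the number of distinct values of $T(i,m,n)$, taken over all $i\ge0$, is at least $k+1$.
   Context: Fibonacci numbers: $F_0=0$, $F_1=1$, $F_{t+1}=F_t+F_{t-1}$ (so $F_{3k}$ is even). *)

(* Defs.v *)
From mathcomp Require Import all_boot all_order all_algebra.
From mathcomp Require Import classical_sets functions cardinality reals.
Set Implicit Arguments.
Unset Strict Implicit.
Unset Printing Implicit Defensive.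
Import Order.TTheory GRing.Theory Num.Theory.
Local Open Scope ring_scope.

Fixpoint fib (n : nat) : nat :=
  match n with
  | 0 => 0
  | 1 => 1
  | (n'.+1 as p).+1 => fib p + fib n'
  end%N.

Lemma dvdn2_fib3 (k : nat) : (2 %| fib (3 * k))%N.
Proof.
elim: k => [|k IHk] //.
have step n : fib n.+3 = (fib n + 2 * fib n.+1)%N.
  have fibSS j : fib j.+2 = (fib j.+1 + fib j)%N by [].
  by rewrite !fibSS mul2n -addnn addnAC addnC.
by rewrite mulnS step dvdn_add // dvdn_mulr.
Qed.

Definition gamma (R : realType) : R := (3 - Num.sqrt 5) / 2.

(* [fibword R j] is the letter f_j, obtained from
   f_(t-1) = floor ((t+1) gamma) - floor (t gamma) with t = j + 1. *)
Definition fibword (R : realType) (j : nat) : int :=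
  Num.floor (j.+2%:R * gamma R) - Num.floor (j.+1%:R * gamma R).

Definition T (R : realType) (i m n : nat) : int :=
  \sum_(0 <= k < m) \sum_(0 <= l < n) fibword R (i + k + l)%N.

(* Main.v *)
(* Write g = (sqrt 5 - 1)/2, so gamma = 1 - g = g^2 and
   F_(e+2) gamma = F_e + (-g)^(e+2).  Since j gamma stays at distance at least
   g^(e+1) from the integers for 0 < j < F_(e+2), translating j by F_(e+2)
   shifts floor (j gamma) by exactly F_e.  The iterated partial sums Q of
   floor (j gamma) are therefore computable at sums of well separated Fibonacci
   numbers, and T(i,m,n) = Q(i+m+n) - Q(i+m) - Q(i+n) + Q(i).
   For n = F_(3k)/2 and I_k = F_3/2 + ... + F_(3k)/2 = (F_(3k+2) - 1)/4 one gets
   T(I_k,n,n) - T(I_(k-1),n,n) = (-1)^(k-1) k.  As T(i+1,n,n) - T(i,n,n) is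
   -1, 0 or 1, all the k + 1 values in between are attained. *)
Require Import Defs.
From mathcomp Require Import all_boot all_order all_algebra.
From mathcomp Require Import classical_sets functions cardinality reals.
From mathcomp Require Import zify ring lra.
Import Order.TTheory GRing.Theory Num.Theory.
Local Open Scope classical_set_scope.
Local Open Scope card_scope.

(** * Fibonacci identities and half sums *)

Lemma fibSS (n : nat) : fib n.+2 = (fib n.+1 + fib n)%N.
Proof. by []. Qed.

Lemma fib_gt0 (n : nat) : (0 < fib n.+1)%N.
Proof. by elim: n => // n IHn; rewrite fibSS addn_gt0 IHn. Qed.

Lemma fib_cassini (n : nat) :
  ((fib n.+1)%:Z ^+ 2 - (fib n.+1)%:Z * (fib n)%:Z - (fib n)%:Z ^+ 2
   = (-1) ^+ n)%R.
Proof.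
elim: n => // n IHn; rewrite fibSS PoszD (exprS _ n) -IHn; ring.
Qed.

Definition half_fib_sum (k : nat) : nat := \sum_(0 <= j < k) fib (3 * j.+1) %/ 2.

Lemma fib3_halfK (k : nat) : (2 * (fib (3 * k) %/ 2))%N = fib (3 * k).
Proof. by rewrite mulnC divnK // dvdn2_fib3. Qed.

Lemma half_fib_sumS (k : nat) :
  half_fib_sum k.+1 = (half_fib_sum k + fib (3 * k.+1) %/ 2)%N.
Proof. by rewrite /half_fib_sum big_nat_recr. Qed.

Lemma half_fib_sumE (k : nat) :
  (4 * half_fib_sum k + 1)%N = fib (3 * k).+2.
Proof.
elim: k => [|k IHk]; first by rewrite /half_fib_sum big_nil.
have := fib3_halfK k.+1; rewrite half_fib_sumS.
have -> : (3 * k.+1 = (3 * k).+3)%N by lia.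
by rewrite !fibSS in IHk *; lia.
Qed.

(** Gives the shape that [Q_fib_add] takes: a Fibonacci number plus a smaller remainder. *)
Lemma half_fib_sumSS (k : nat) :
  half_fib_sum k.+2 = (fib (3 * k).+4.+1 + half_fib_sum k)%N.
Proof.
have := half_fib_sumE k; have := half_fib_sumE k.+2.
have -> : (3 * k.+2 = (3 * k).+4.+2)%N by lia.
by rewrite !fibSS; lia.
Qed.

Lemma int_ivt (h : nat -> int) (v : int) (i j : nat) :
  (forall t, (`|h t.+1 - h t| <= 1)%R) -> (i <= j)%N ->
  (h i <= v <= h j)%R || (h j <= v <= h i)%R -> exists t, h t = v.
Proof.
move=> h1; elim: j => [|j IHj].
  rewrite leqn0 => /eqP -> hv; exists 0%N; lia.
rewrite leq_eqVlt => /orP[/eqP -> hv|]; first by exists j.+1; lia.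
rewrite ltnS => /IHj {}IHj hv.
have hj := h1 j.
case: (eqVneq v (h j.+1)) => [->|hne]; first by exists j.+1.
by apply: IHj; lia.
Qed.

(** * Powers of the golden section and distances to the integers *)

Definition gold (R : realType) : R := (1 - gamma R)%R.

Section FloorGamma.

Variable R : realType.
Local Open Scope ring_scope.

Local Notation g := (gold R).

Lemma gold_sqr : g ^+ 2 = 1 - g.
Proof.
have h5 : Num.sqrt 5 ^+ 2 = 5 :> R by rewrite sqr_sqrtr.
by rewrite /gold /gamma; move: (Num.sqrt 5) h5 => s h5; nra.
Qed.

Lemma gold_bounds : 1 / 2 <= g <= 1.
Proof.
have h2 := gold_sqr.
have g0 : 0 <= g.
  have h5 : 1 <= Num.sqrt 5 :> R.
    by rewrite -[X in X <= _]sqrtr1 ler_wsqrtr // ler1n.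
  by rewrite /gold /gamma; lra.
by apply/andP; split; nra.
Qed.

Lemma gammaE : gamma R = 1 - g.
Proof. by rewrite /gold; ring. Qed.

Lemma goldX_ge0 (e : nat) : 0 <= g ^+ e.
Proof. by apply: exprn_ge0; have := gold_bounds; lra. Qed.

Lemma goldXS_le (e : nat) : g ^+ e.+1 <= g ^+ e.
Proof.
by rewrite exprS ler_piMl ?goldX_ge0 //; have /andP[] := gold_bounds.
Qed.

Lemma goldXSS (e : nat) : g ^+ e.+2 = g ^+ e - g ^+ e.+1.
Proof. by rewrite -addn2 exprD gold_sqr exprS; ring. Qed.

Lemma fib_gamma (e : nat) :
  (fib e.+2)%:R * gamma R = (fib e)%:R + (- g) ^+ e.+2.
Proof.
suff: (fib e.+2)%:R * gamma R = (fib e)%:R + (- g) ^+ e.+2 /\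
      (fib e.+3)%:R * gamma R = (fib e.+1)%:R + (- g) ^+ e.+3 by case.
have h2 := gold_sqr; rewrite gammaE; elim: e => [|e [IH1 IH2]].
  by rewrite /= !exprS expr0; split; nra.
split=> //; rewrite (fibSS e.+2) natrD mulrDl IH1 IH2 (fibSS e) natrD.
have -> : (- g) ^+ e.+4 = (- g) ^+ e.+2 * (1 - g) by rewrite -h2 !exprS; ring.
by rewrite (exprS _ e.+2); ring.
Qed.

Lemma goldNX_bounds (e : nat) : - g ^+ e <= (- g) ^+ e <= g ^+ e.
Proof.
by rewrite -ler_norml normrX normrN ger0_norm //; have := gold_bounds; lra.
Qed.

Lemma gamma_dist (e j : nat) : (0 < j < fib e.+2)%N ->
  exists p : int, g ^+ e.+1 <= j%:R * gamma R - p%:~R <= 1 - g ^+ e.+1.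
Proof.
(* Two consecutive ranges share the induction: for j > F_(d+2) the remainder j - F_(d+2) is below
   F_(d+1), and its margin g^d absorbs the error g^(d+2). *)
suff H d : (forall j, (0 < j < fib d.+1)%N -> exists p : int,
              g ^+ d <= j%:R * gamma R - p%:~R <= 1 - g ^+ d) /\
           (forall j, (0 < j < fib d.+2)%N -> exists p : int,
              g ^+ d.+1 <= j%:R * gamma R - p%:~R <= 1 - g ^+ d.+1).
  exact: (H e).2.
have hb := gold_bounds.
elim: d => [|d [IH1 IH2]].
  by split=> i /=; case: i => [|[|i]] //.
split=> // i; rewrite fibSS => /andP[i0 ilt].
have mono1 := goldXS_le d.+1; have mono2 := goldXS_le d.
have ha := goldX_ge0 d; have hX := goldXSS d.
have /andP[gl gu] := goldNX_bounds d.+2.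
have hF := fib_gamma d.
(* For i = F_(d+2) the distance is exactly g^(d+2), so the bound on the opposite side needs it to be
   at most 1/2. *)
have d2 : g ^+ d.+2 <= 1 / 2.
  rewrite -addn2 exprD gold_sqr.
  have : g ^+ d <= 1 by rewrite exprn_ile1 //; lra.
  nra.
case: (ltngtP i (fib d.+2)) => [lti|gti|eqi].
- have [|p hp] := IH2 i; first by rewrite i0.
  by exists p; lra.
- have [|p hp] := IH1 (i - fib d.+2)%N; first lia.
  exists (p + fib d)%R.
  have -> : i = (fib d.+2 + (i - fib d.+2))%N by lia.
  rewrite natrD mulrDl hF rmorphD /= -pmulrn.
  lra.
- rewrite eqi hF.
  have gpos : (- g) ^+ d.+2 = g ^+ d.+2 \/ (- g) ^+ d.+2 = - g ^+ d.+2.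
    by rewrite exprNn -signr_odd; case: odd; [right|left]; ring.
  case: gpos => ->.
    by exists (fib d : int); rewrite -pmulrn; lra.
  exists ((fib d : int) - 1); rewrite rmorphB /= -pmulrn; lra.
Qed.

(** * Floors of multiples of gamma and their partial sums *)

Definition Fl (j : nat) : int := Num.floor (j%:R * gamma R).

Lemma Fl_itv (j : nat) : (Fl j)%:~R <= j%:R * gamma R < (Fl j)%:~R + 1.
Proof. by have := floor_itv (j%:R * gamma R); rewrite rmorphD. Qed.

Lemma Fl_eq (j : nat) (p : int) :
  p%:~R <= j%:R * gamma R < p%:~R + 1 -> Fl j = p.
Proof. by move=> h; apply: floor_def; rewrite rmorphD. Qed.

Lemma Fl_fib_add (e j : nat) : (0 < j < fib e.+2)%N ->
  Fl (fib e.+2 + j) = (fib e)%:Z + Fl j.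
Proof.
move=> hj; have [p hp] := gamma_dist _ _ hj.
have pos : 0 < g ^+ e.+1 by apply: exprn_gt0; have := gold_bounds; lra.
(* Strictness keeps the shifted fractional part below 1. *)
have lt_gX : g ^+ e.+2 < g ^+ e.+1.
  rewrite goldXSS; have := goldXSS e; have := goldXS_le e.+1.
  by have h2 := gold_sqr; have hb := gold_bounds; rewrite exprS in pos *; nra.
have /andP[gl gu] := goldNX_bounds e.+2.
have -> : Fl j = p by apply: Fl_eq; lra.
apply: Fl_eq; rewrite natrD mulrDl fib_gamma rmorphD /= -pmulrn; lra.
Qed.

(** The sum starts at [Fl 1] because f_j = Fl (j+2) - Fl (j+1). This also keeps j = 0, where the
    shift in [Fl_fib_add] fails for odd e, out of [Q_fib_add]. *)
Definition Q (j : nat) : int := \sum_(0 <= t < j) Fl t.+1.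

Lemma Q0 : Q 0 = 0. Proof. by rewrite /Q big_nil. Qed.

Lemma QS (j : nat) : Q j.+1 = Q j + Fl j.+1.
Proof. by rewrite /Q big_nat_recr. Qed.

Lemma Q_fib_add (e r : nat) : (r < fib e.+2)%N ->
  Q (fib e.+2 + r) = Q (fib e.+2) + r%:Z * (fib e)%:Z + Q r.
Proof.
elim: r => [|r IHr] hr; first by rewrite addn0 Q0 mul0r !addr0.
by rewrite addnS !QS IHr 1?ltnW // -addnS Fl_fib_add //; lia.
Qed.

Lemma Q_fibS (e : nat) :
  Q (fib e.+4) = Q (fib e.+3) + (fib e.+2)%:Z * (fib e.+1)%:Z + Q (fib e.+2).
Proof.
rewrite (fibSS e.+2) Q_fib_add //.
by rewrite (fibSS e.+1) -{1}[fib e.+2]addn0 ltn_add2l fib_gt0.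
Qed.

Lemma T_Q (i m n : nat) :
  T R i m n = Q (i + m + n) - Q (i + m) - Q (i + n) + Q i.
Proof.
have row k : \sum_(0 <= l < n) fibword R (i + k + l) =
             Fl (i + k + n).+1 - Fl (i + k).+1.
  elim: n => [|n IHn]; first by rewrite big_nil addn0 subrr.
  by rewrite big_nat_recr //= IHn /fibword -/(Fl _) -/(Fl _) !addnS; ring.
rewrite /T (eq_bigr _ (fun k _ => row k)).
elim: m => [|m IHm]; first by rewrite big_nil addn0; ring.
by rewrite big_nat_recr //= IHm !addnS !addSn !QS (addnAC i); ring.
Qed.

Lemma Fl_sub_itv (a m : nat) : Fl m <= Fl (a + m) - Fl a <= Fl m + 1.
Proof.
have := Fl_itv a; have := Fl_itv m; have := Fl_itv (a + m).
rewrite natrD mulrDl => h1 h2 h3.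
have : (Fl m + Fl a)%:~R < (Fl (a + m) + 1)%:~R :> R by rewrite !rmorphD /=; lra.
have : (Fl (a + m))%:~R < (Fl m + Fl a + 2)%:~R :> R by rewrite !rmorphD /=; lra.
by rewrite !ltr_int; lia.
Qed.

(** The increment is the difference of [Fl (a + m) - Fl a] at a = i+n+1 and at a = i+1; each is
    [Fl m] or [Fl m + 1]. *)
Lemma T_step (m n i : nat) : `|T R i.+1 m n - T R i m n| <= 1.
Proof.
rewrite !T_Q !addSn !QS.
have := Fl_sub_itv i.+1 m; have := Fl_sub_itv (i + n).+1 m.
rewrite !addSn (addnAC i); lia.
Qed.

(* The left-hand side is T(I_(k+1),n,n) - T(I_k,n,n) for n = F_(3k+3)/2, the
   third difference of Q at I_k with step n, simplified by [Q_fib_add]. *)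
Lemma Q_half_fib_sum (k : nat) :
  4 * Q (half_fib_sum k.+1) - 4 * Q (half_fib_sum k)
  - 2 * Q (fib (3 * k).+3)
  + (fib (3 * k).+1)%:Z * ((half_fib_sum k.+1)%:Z - 3 * (half_fib_sum k)%:Z)
  = (-1) ^+ k * k.+1%:Z.
Proof.
elim: k => [|k IHk].
  have I1 : half_fib_sum 1 = 1%N by rewrite /half_fib_sum big_nat1.
  have I0 : half_fib_sum 0 = 0%N by rewrite /half_fib_sum big_nil.
  have hb := gold_bounds.
  have g2 := gold_sqr.
  have F1 : Fl 1 = 0 by apply: Fl_eq; rewrite gammaE; nra.
  have F2 : Fl 2 = 0 by apply: Fl_eq; rewrite gammaE; nra.
  by rewrite I1 I0 /= !QS Q0 F1 F2.
have e3 : (3 * k.+1 = (3 * k).+3)%N by lia.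
have lt_sum : (half_fib_sum k < fib (3 * k).+3.+2)%N.
  by have := half_fib_sumE k; rewrite !fibSS; lia.
(* On adding the cases k and k+1, these recurrences cancel every [Q]; what remains is F_(3k)^2 +
   F_(3k) F_(3k+1) - F_(3k+1)^2, which is -(-1)^k by Cassini. *)
have HA := Q_fibS (3 * k).+2; have HB := Q_fibS (3 * k).+1.
have HQ := Q_fib_add _ _ lt_sum; rewrite -half_fib_sumSS in HQ.
have hE := half_fib_sumE k; have hE1 := half_fib_sumE k.+1.
have hC := fib_cassini (3 * k).
have sgn : (-1) ^+ (3 * k) = (-1) ^+ k :> int by rewrite exprM.
rewrite sgn in hC; rewrite e3 in hE1 *.
rewrite exprS HQ HA.
rewrite half_fib_sumSS.
move: IHk hC HB; move: ((-1) ^+ k) => s.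
move: (Q _) (Q _) (Q _) (Q _) (Q _) => q1 q2 q3 q4 q5.
rewrite !fibSS in hE hE1 *.
move: hE hE1; move: (half_fib_sum _) (half_fib_sum _) => x y hE hE1.
move: hE hE1; move: (fib _) (fib _) => a b hE hE1.
move=> IHk hC HB.
(* Here a = F_(3k), b = F_(3k+1), y = I_k and x = I_(k+1). Eliminating a and b makes the goal linear
   in the remaining monomials. *)
have ea : (a : int) = 4 * y%:Z + 1 - b%:Z by lia.
have eb : (b : int) = 2 * x%:Z - 6 * y%:Z - 1 by lia.
move: IHk hC; rewrite HB !PoszD ea eb => IHk hC.
lia.
Qed.

End FloorGamma.

(** * Counting the values *)

Theorem theorem8 (R : realType) (k m n : nat) (hk : (1 <= k)%N)
    (hm : m = (fib (3 * k) %/ 2)%N) (hn : n = (fib (3 * k) %/ 2)%N) :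
  `I_(k.+1) #<= [set T R i m n | i in [set: nat]].
Proof.
case: k hk hm hn => // k _ -> -> {m n}; set n := (_ %/ 2)%N.
pose h i := T R i n n.
have nE : (n + n = fib (3 * k).+3)%N.
  have -> : (3 * k).+3 = (3 * k.+1)%N by lia.
  by have := fib3_halfK k.+1; rewrite -/n; lia.
have hD : (h (half_fib_sum k.+1) - h (half_fib_sum k) = (-1) ^+ k * k.+1%:Z)%R.
  have hE := half_fib_sumE k.
  (* Since 2n = F_(3k+3) and I_k + n = I_(k+1), the arguments of [Q] beyond I_(k+1) are F_(3k+3)
     plus I_k or I_(k+1), both admissible remainders. *)
  have lt1 : (half_fib_sum k < fib (3 * k).+1.+2)%N.
    by rewrite !fibSS in hE *; lia.
  have lt2 : (half_fib_sum k.+1 < fib (3 * k).+1.+2)%N.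
    by rewrite half_fib_sumS -/n; rewrite !fibSS in hE nE *; lia.
  rewrite /h !T_Q -(Q_half_fib_sum R).
  have -> : (half_fib_sum k.+1 + n + n
             = fib (3 * k).+1.+2 + half_fib_sum k.+1)%N by lia.
  have -> : (half_fib_sum k.+1 + n = fib (3 * k).+1.+2 + half_fib_sum k)%N.
    by rewrite half_fib_sumS -/n; lia.
  have -> : (half_fib_sum k + n + n
             = fib (3 * k).+1.+2 + half_fib_sum k)%N by lia.
  have -> : (half_fib_sum k + n = half_fib_sum k.+1)%N by rewrite half_fib_sumS.
  by rewrite (Q_fib_add _ _ _ lt1) (Q_fib_add _ _ _ lt2); ring.
have le_sum : (half_fib_sum k <= half_fib_sum k.+1)%N.
  by rewrite half_fib_sumS leq_addr.
have h1 t : (`|h t.+1 - h t| <= 1)%R by apply: T_step.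
(* The smaller endpoint value, by the sign in [hD]. As [k] is now one less than in the statement,
   k+2 values are needed. *)
pose v := if odd k then h (half_fib_sum k.+1) else h (half_fib_sum k).
pose u (j : nat) := (v + j%:Z)%R.
have u_inj : injective u by move=> a b /addrI [].
apply: (@card_le_trans _ _ _ (u @` `I_k.+2)).
  have /card_esym := @inj_card_eq _ _ `I_k.+2 u (in2W u_inj).
  by rewrite card_eq_le => /andP[].
apply: subset_card_le => _ [j /= hj <-].
have [|t <-] := @int_ivt h (u j) _ _ h1 le_sum; last by exists t.
rewrite /u /v; move: hD; rewrite -signr_odd; case: odd;
  rewrite ?expr0 ?expr1; lia.
Qed.
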